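(* Let $G$ be an uncountable subgroup of $(\mathbb R,+)$. Then the infinite system of equations $y_n=x_n-x_{n+1}$ ($n=0,1,2,\ldots$), in the unknowns $x_0,x_1,\ldots$ and $y_0,y_1,\ldots$, is partition regular over $G$ but not partition regular over $\mathbb Q$.
   Context: A system of linear equations is partition regular over a set $S\subseteq\mathbb R$ if, whenever $S\setminus\{0\}$ is finitely coloured, there is a solution of the system with all variables taking values in one colour class. *)

(* Defs.v *)
From mathcomp Require Import all_boot all_order all_algebra.
From mathcomp Require Import boolp classical_sets cardinality reals.

Set Implicit Arguments.
Unset Strict Implicit.
Unset Printing Implicit Defensive.

Import Order.TTheory GRing.Theory Num.Theory.
Local Open Scope classical_set_scope.
Local Open Scope ring_scope.

(* A system of linear equations in unknowns indexed by V is represented by its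
   set of solutions in R, so linearity itself is not part of the encoding.
   A finite colouring of S \ {0} is the restriction of some c : R -> 'I_k; the
   values of c off S \ {0} play no role. *)
Definition partition_regular (R : realType) (V : Type) (system : set (V -> R))
    (S : set R) : Prop :=
  forall (k : nat) (c : R -> 'I_k),
    exists2 z : V -> R, system z &
      exists i : 'I_k, forall v : V, (S `\ 0) (z v) /\ c (z v) = i.

(* The unknowns are indexed by nat + nat: x_n is z (inl n), y_n is z (inr n). *)
Definition difference_system (R : realType) : set (nat + nat -> R) :=
  [set z | forall n : nat, z (inr n) = z (inl n) - z (inl n.+1)].

(* Main.v *)
Require Import Defs.
From mathcomp Require Import all_boot all_order all_algebra.
From mathcomp Require Import boolp classical_sets cardinality reals.
From mathcomp Require Import zify ring lra.

Import Order.TTheory GRing.Theory Num.Theory.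
Local Open Scope classical_set_scope.
Local Open Scope ring_scope.

(* Over G: given an uncountable G and a colouring of pairs, the Erdos-Rado tree
   argument for omega_1 -> (omega + 1)^2_k gives a_0, a_1, ... and b in G with
   all pairs of one colour. Colouring the pair (x, y) like x - y, the solution
   is x_n = a_n - b and y_n = a_n - a_(n+1).

   Over Q: let N_j = 2^j j! and let the level of x be the least j with N_j x an
   integer. Colour x by its sign, the parity of its level j, and the parity of
   floor (2 N_(j-2) x). If x, y and x + y have the same colour and x + y has
   level less than x, then by parity its level is at most j - 2, so N_(j-2) x
   and N_(j-2) y add up to an integer. As 2 N_(j-2) x is not an integer (it
   would make N_(j-1) x one), the third components of x and y differ. Hence
   in a monochromatic solution the levels of the x_n are at most d, the level
   of x_0, and N_d |x_n| is a strictly decreasing sequence of naturals. *)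

Lemma constant_subsequence {C : finType} (f : nat -> C) :
  exists (g : nat -> nat) (i : C),
    (forall m n, (m < n)%N -> (g m < g n)%N) /\ forall n, f (g n) = i.
Proof.
have [i fi] : exists i, forall n, exists m, (n <= m)%N && (f m == i).
  apply: contrapT => nofi.
  have bnd i : exists n, forall m, (n <= m)%N -> f m != i.
    apply: contrapT => nobnd; apply: nofi; exists i => n.
    apply: contrapT => nom; apply: nobnd; exists n => m nm.
    by apply/negP => fm; apply: nom; exists m; rewrite nm.
  have [b bP] := choice bnd.
  pose n := \max_i b i.
  by have /eqP := bP (f n) n (leq_bigmax (f n)).
have [h hP] := choice fi.
have hle n : (n <= h n)%N by case/andP: (hP n).
have hi n : f (h n) = i by case/andP: (hP n) => _ /eqP.
pose g n := iter n (fun m => h m.+1) (h 0%N).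
exists g, i; split=> [m n|]; last by case=> [|n]; rewrite /g ?iterS hi.
apply: (homo_ltn (f := g) (r := fun x y => x < y)%N) => [y x z|{}n].
  exact: ltn_trans.
by rewrite /g iterS; exact: hle.
Qed.

(* A path of the tree is coded by the word t of colours seen along it, most
   recent first: the next vertex after t is the chosen w s t, where s lists the
   vertices already on the path. *)
Fixpoint tree_path {T C : Type} (w : seq T -> seq C -> T) (t : seq C) : seq T :=
  if t is _ :: t' then w (tree_path w t') t' :: tree_path w t' else [::].

(** Words over [C] are countable, so the tree has countably many vertices and some [b] in [A] is not
    one of them. Following the colours towards [b] gives an infinite branch whose vertices see all
    later ones in the colour in which they see [b]; a subsequence makes that colour constant. *)
Lemma uncountable_homogeneous {T : eqType} {C : finType} {A : set T}
    (c : T -> T -> C) : ~ countable A ->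
  exists (a : nat -> T) (b : T) (i : C),
    [/\ A b, forall n, [/\ A (a n), a n != b & c (a n) b = i] &
      forall m n, (m < n)%N -> a m != a n /\ c (a m) (a n) = i].
Proof.
move=> Auncountable.
pose good s t x := [/\ A x, x \notin s & [seq c a x | a <- s] = t].
have [x0 Ax0] : exists x, A x.
  apply: contrapT => A0; apply: Auncountable.
  suff -> : A = set0 by exact: countable0.
  by apply/seteqP; split=> // x Ax; apply: A0; exists x.
have /choice[w wP] : forall st : seq T * seq C, exists y,
    (exists x, good st.1 st.2 x) -> good st.1 st.2 y.
  case=> s t /=.
  have [[x gx]|ng] := pselect (exists x, good s t x); first by exists x.
  by exists x0 => gx; case: ng.
pose W s t := w (s, t); pose u t := W (tree_path W t) t.
have [b [Ab ub]] : exists b, A b /\ forall t, u t != b.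
  apply: contrapT => nob; apply: Auncountable.
  apply: (@sub_countable _ _ _ (range u)); last first.
    exact: card_le_trans (card_image_le _ _) (countableP _).
  apply: subset_card_le => x Ax; apply: contrapT => nx.
  apply: nob; exists x; split=> // t; apply/eqP => utx.
  by apply: nx; exists t.
pose t n := iter n (fun t => c (u t) b :: t) [::].
pose a n := u (t n).
have pathS n : tree_path W (t n.+1) = a n :: tree_path W (t n) by [].
have good_b n : good (tree_path W (t n)) (t n) b.
  split=> //; elim: n => // n IHn.
    by rewrite pathS inE negb_or IHn eq_sym ub.
  by rewrite pathS /= IHn.
have good_a n : good (tree_path W (t n)) (t n) (a n).
  exact: (wP (_, _) (ex_intro _ b (good_b n))).
have a_path m n : (m < n)%N -> a m \in tree_path W (t n).
  elim: n => // n IHn; rewrite ltnS leq_eqVlt pathS inE.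
  by case/predU1P => [->|/IHn ->]; rewrite ?eqxx ?orbT.
(* Both [a n] and [b] are [good] for the word [t n], so each earlier vertex sees them in the same
   colour. *)
have endhom m n : (m < n)%N -> c (a m) (a n) = c (a m) b.
  move=> /a_path am; have [_ _ ca] := good_a n; have [_ _ cb] := good_b n.
  have /eq_in_map : [seq c x (a n) | x <- tree_path W (t n)] =
    [seq c x b | x <- tree_path W (t n)] by rewrite ca cb.
  exact.
have [g [i [gmono gi]]] := constant_subsequence (fun n => c (a n) b).
exists (a \o g), b, i; split=> // [n|m n /gmono gmn] /=.
  by split=> //; [case: (good_a (g n)) | exact: ub].
split; last by rewrite endhom // gi.
have [_ an _] := good_a (g n).
by apply: contraNneq an => <-; exact: a_path.
Qed.

Section Rationals.
Context {R : realType}.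
Implicit Types x y t : R.

(** The factorial ensures that every rational has a level; the power of 2 makes [N j.+1] a multiple
    of [2 * N j]. *)
Definition level_denominator (j : nat) : nat := 2 ^ j * j`!.
Local Notation N := level_denominator.

Lemma int_denominator_le {i j : nat} {x} : (i <= j)%N ->
  (N i)%:R * x \is a Num.int -> (N j)%:R * x \is a Num.int.
Proof.
move=> ij Nix.
have /dvdnP[q ->] : (N i %| N j)%N.
  by rewrite dvdn_mul ?dvdn_exp2l // -(bin_fact ij) dvdn_mull // dvdn_mulr.
by rewrite natrM -mulrA rpredM ?natr_int.
Qed.

Lemma int_denominatorS {j : nat} {x} :
  (N j)%:R * (2 * x) \is a Num.int -> (N j.+1)%:R * x \is a Num.int.
Proof.
move=> Nj2x.
have -> : N j.+1 = (j.+1 * (N j * 2))%N by rewrite /N expnS factS; lia.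
by rewrite 2!natrM -!mulrA rpredM ?natr_int.
Qed.

Lemma rational_level {x} : rational x -> exists j, (N j)%:R * x \is a Num.int.
Proof.
move=> /rationalP[a [b ->]]; exists b.
have [->|b0] := eqVneq b 0%N; first by rewrite invr0 !mulr0.
have /dvdnP[q ->] : (b %| N b)%N by rewrite dvdn_mull // dvdn_fact ?leqnn // lt0n b0.
by rewrite natrM mulrACA mulfV ?pnatr_eq0 // mulr1 rpredM ?natr_int ?intr_int.
Qed.

(* 0 when x is irrational. *)
Definition level x : nat :=
  if pselect (exists j, (N j)%:R * x \is a Num.int) is left e
  then ex_minn e else 0%N.

Lemma levelP {x} : rational x -> (N (level x))%:R * x \is a Num.int.
Proof.
by move=> /rational_level e; rewrite /level; case: pselect => // e'; case: ex_minnP.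
Qed.

Lemma level_le {j x} : (N j)%:R * x \is a Num.int -> (level x <= j)%N.
Proof.
move=> Njx; rewrite /level; case: pselect => // e; case: ex_minnP => m _.
exact.
Qed.

(** As [2 * t + 2 * u] is an even integer and [2 * t] is not an integer, the two floors add up to an
    odd number. *)
Lemma odd_floor_double t u : t + u \is a Num.int -> 2 * t \isn't a Num.int ->
  odd `|Num.floor (2 * t)| != odd `|Num.floor (2 * u)|.
Proof.
move=> /intrP[m tum] t2.
have -> : 2 * u = (2 * m)%:~R + - (2 * t) by rewrite intrM -tum; ring.
rewrite floorDzr ?intr_int // intrKfloor.
have -> : Num.floor (- (2 * t)) = - (Num.floor (2 * t) + 1).
  by rewrite floorNceil opprK ceil_floor t2.
lia.
Qed.

Definition colour x : bool * bool * bool :=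
  (0 < x, odd (level x),
   odd `|Num.floor (2 * ((N (level x - 2))%:R * x))|).

Lemma level_le_sum x y : rational x -> rational y -> rational (x + y) ->
  colour x = colour (x + y) -> colour y = colour (x + y) ->
  (level x <= level (x + y))%N.
Proof.
move=> Qx Qy Qxy [_ oddx fx] [_ oddy fy]; rewrite leqNgt; apply/negP => lt.
(* Equal parity makes the gap at least 2, so [level x - 2] is not truncated here. *)
have le2 : (level (x + y) <= level x - 2)%N by lia.
have Nxy := int_denominator_le le2 (levelP Qxy).
(* Each of [x], [y] is [x + y] minus the other. As [x + y] has a lower level, theirs agree, so both
   third components use the same [N]. *)
have ley : (level y <= level x)%N.
  apply: level_le; rewrite -[X in _ * X](addKr x) mulrDr mulrN.
  rewrite rpredD ?rpredN ?levelP //.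
  exact: int_denominator_le (ltnW lt) (levelP Qxy).
have lex : (level x <= level y)%N.
  rewrite leqNgt; apply/negP => lt'.
  suff : (level x <= (level x).-1)%N by lia.
  apply: level_le; rewrite -[X in _ * X](addrK y) mulrBr rpredB //.
    by apply: int_denominator_le (levelP Qxy); lia.
  by apply: int_denominator_le (levelP Qy); lia.
have eyx : level y = level x by lia.
pose M := (N (level x - 2))%:R : R.
suff : odd `|Num.floor (2 * (M * x))| != odd `|Num.floor (2 * (M * y))|.
  by rewrite /M fx -eyx fy eqxx.
apply: odd_floor_double; first by rewrite -mulrDr.
by apply/negP; rewrite mulrCA => /int_denominatorS/level_le; lia.
Qed.

Lemma rational_not_partition_regular :
  ~ partition_regular (@difference_system R) (@rational R).
Proof.
move=> /(_ _ (enum_rank \o colour))[z zsys [i zP]].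
have Q v : rational (z v) by case: (zP v) => -[].
have z0 v : z v != 0 by case: (zP v) => -[_ /eqP].
have col v w : colour (z v) = colour (z w).
  by apply: enum_rank_inj; case: (zP v) => _ /= ->; case: (zP w) => _ /= ->.
have xE n : z (inl n) = z (inl n.+1) + z (inr n) by rewrite zsys; ring.
have lev n : (level (z (inl n)) <= level (z (inl 0%N)))%N.
  elim: n => // n; apply: leq_trans; rewrite [in leqRHS]xE.
  by apply: level_le_sum; rewrite -?xE.
pose d := level (z (inl 0%N)).
have sg v w : (0 < z v) = (0 < z w) by have := col v w; case.
(* The nonzero numbers x_(n+1) and y_n have the same sign and sum x_n, so their absolute values
   add. *)
have dec n : `|z (inl n.+1)| < `|z (inl n)|.
  have := xE n; have := sg (inl n) (inr n); have := sg (inl n.+1) (inr n).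
  have := z0 (inr n); have := z0 (inl n); have := z0 (inl n.+1).
  by case: ltrgt0P => // ?; case: ltrgt0P => // ?; case: ltrgt0P => // ? *; lra.
have natx n : (N d)%:R * `|z (inl n)| \is a Num.nat.
  rewrite -[(N d)%:R]normr_nat -normrM natr_norm_int //.
  exact: int_denominator_le (lev n) (levelP (Q _)).
have N0 : 0 < (N d)%:R :> R by rewrite ltr0n muln_gt0 expn_gt0 fact_gt0.
pose f n := Num.truncn ((N d)%:R * `|z (inl n)|).
have fdec n : (f n.+1 < f n)%N.
  by rewrite -(ltr_nat R) !truncnK // ltr_pM2l.
have fle n : (f n + n <= f 0)%N.
  by elim: n => [|n IHn]; [rewrite addn0 | have := fdec n; lia].
have := fle (f 0%N).+1; lia.
Qed.

End Rationals.

Theorem theorem4p7 (R : realType) (G : set R)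
    (G_subgroup : zmod_closed (mem G)) (G_uncountable : ~ countable G) :
  partition_regular (@difference_system R) G /\
  ~ partition_regular (@difference_system R) (@rational R).
Proof.
split; last exact: rational_not_partition_regular.
move=> k c.
have [_ GB] := G_subgroup.
have [a [b [i [Gb ab aa]]]] :=
  uncountable_homogeneous (fun x y => c (x - y)) G_uncountable.
have GB' x y : G x -> G y -> G (x - y).
  by move=> Gx Gy; apply: set_mem; apply: GB; apply: mem_set.
exists (fun v => match v with inl n => a n - b | inr n => a n - a n.+1 end).
  by move=> n /=; ring.
exists i => -[] n.
  have [Ga nab cab] := ab n; split=> //; split; first exact: GB'.
  by apply/eqP; rewrite subr_eq0.
have [Ga _ _] := ab n; have [Ga' _ _] := ab n.+1.
have [naa caa] := aa n n.+1 (ltnSn n); split=> //; split; first exact: GB'.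
by apply/eqP; rewrite subr_eq0.
Qed.
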